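(* $n^{-2/3}$ is a distance threshold for $G(n,r)$ to be plane: if $r=o(n^{-2/3})$ then w.h.p. $G(n,r)$ is plane, and if $r=\omega(n^{-2/3})$ then w.h.p. $G(n,r)$ is not plane.
   Context: The random geometric graph $G(n,r)$ is formed by choosing $n$ points independently and uniformly at random in the unit square $[0,1]^2$; two points are joined by a straight-line edge iff their Euclidean distance is at most $r$, where $r=r(n)\to 0$ as $n\to\infty$. Two segments cross if they share a point interior to both; a geometric graph is plane if no two of its edges cross. ''W.h.p.'' means with probability tending to $1$ as $n\to\infty$. *)

(* Defs.v *)
From HB Require Import structures.
From mathcomp Require Import all_boot all_order all_algebra.
From mathcomp Require Import all_classical all_reals all_analysis.
Set Implicit Arguments. Unset Strict Implicit. Unset Printing Implicit Defensive.
Import Order.TTheory GRing.Theory Num.Theory.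
Import numFieldNormedType.Exports.
Local Open Scope classical_set_scope.
Local Open Scope ring_scope.

Definition pt (R : realType) := (measurableTypeR R * measurableTypeR R)%type.

Definition edist (R : realType) (p q : R * R) : R :=
  Num.sqrt ((p.1 - q.1) ^+ 2 + (p.2 - q.2) ^+ 2).

Definition open_seg (R : realType) (a b : R * R) : set (R * R) :=
  [set z | exists t : R, 0 < t < 1 /\
      z = (a.1 + t * (b.1 - a.1), a.2 + t * (b.2 - a.2))].

Definition seg_cross (R : realType) (a b c d : R * R) : Prop :=
  exists z, open_seg a b z /\ open_seg c d z.

Definition rgg_edge (R : realType) (p : nat -> R * R) (n : nat) (r : R)
    (i j : nat) : Prop :=
  (i < n)%N /\ (j < n)%N /\ i <> j /\ edist (p i) (p j) <= r.

Definition rgg_plane (R : realType) (p : nat -> R * R) (n : nat) (r : R)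
    : Prop :=
  forall i j k l : nat,
    rgg_edge p n r i j -> rgg_edge p n r k l ->
    ~ ((i = k /\ j = l) \/ (i = l /\ j = k)) ->
    ~ seg_cross (p i) (p j) (p k) (p l).

Definition iid_indep (d : measure_display) (T : measurableType d)
    (R : realType) (P : probability T R) (X : nat -> T -> pt R) : Prop :=
  forall (s : seq nat) (A : nat -> set (pt R)),
    uniq s -> (forall i, measurable (A i)) ->
    P (\big[setI/setT]_(i <- s) (X i @^-1` A i)) =
    (\prod_(i <- s) P (X i @^-1` A i))%E.

Definition unif_square (d : measure_display) (T : measurableType d)
    (R : realType) (P : probability T R) (Y : T -> pt R) : Prop :=
  forall A : set (pt R), measurable A ->
    P (Y @^-1` A) =
    ((@lebesgue_measure R) \x (@lebesgue_measure R))%E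
      (A `&` (`[0, 1] `*` `[0, 1])).

(* Main.v *)
(** Below the threshold, two crossing edges with four distinct endpoints give
    four points in a box of side O(r); summing over the cells of a grid of mesh
    about 2r, this has probability O(n^4 r^6) = O((r n^(2/3))^6). Crossing
    edges with a common endpoint force three collinear points, a null event by
    Fubini.

    Above the threshold, cut the square into K^2 cells of side 1/K <= r/2 and
    split the points into four blocks of size about n/4. Call a cell occupied
    if block 0 hits its left middle ninth, block 1 the right one, block 2 the
    bottom one and block 3 the top one; this forces a crossing. If a block hits
    a given ninth with probability q, a cell is occupied with probability q^4,
    and two distinct cells are negatively correlated because
    1 - 2p <= (1 - p)^2. So by the second moment method some cell is occupied
    with probability at least 1 - 1/(K^2 q^4), where q >= mp/(1 + mp) with
    m = n/4 and p = 1/(9 K^2). *)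

From Pilot Require Import Defs.
From HB Require Import structures.
From mathcomp Require Import all_boot all_order all_algebra.
From mathcomp Require Import all_classical all_reals all_analysis.
From mathcomp Require Import measurable_realfun giry ring lra zify.
Set Implicit Arguments. Unset Strict Implicit. Unset Printing Implicit Defensive.
Import Order.TTheory GRing.Theory Num.Theory.
Import numFieldNormedType.Exports.
Local Open Scope classical_set_scope.
Local Open Scope ring_scope.

(* [edist] would otherwise refer to the extended pseudometric distance of
   MathComp-Analysis. *)
Local Notation edist := Pilot.Defs.edist.

(** * Plane geometry of crossing segments *)

Section crossing.
Variable R : realType.
Implicit Types (u v w : R) (a b c e : R * R).

(** The range of [t * u - s * v] for [t], [s] in the open unit interval: an open interval with these
    endpoints, or the single value 0 when [u] and [v] both vanish. *)
Definition interval_cross u v w : bool :=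
  [&& u == 0, v == 0 & w == 0] ||
  (Num.min 0 u - Num.max 0 v < w) && (w < Num.max 0 u - Num.min 0 v).

Lemma interval_crossP u v w :
  (exists t s : R, [/\ 0 < t < 1, 0 < s < 1 & t * u - s * v = w]) <->
  interval_cross u v w.
Proof.
split=> [[t [s [/andP[t0 t1] /andP[s0 s1] <-]]]|].
  rewrite /interval_cross.
  have [->|u0] := eqVneq u 0; have [->|v0] := eqVneq v 0 => /=.
  - by rewrite !mulr0 subr0 eqxx.
  - rewrite /Num.min /Num.max ltxx.
    by case: (ltP 0 v) => h; apply/andP; split; nra.
  - rewrite /Num.min /Num.max ltxx.
    by case: (ltP 0 u) => h; apply/andP; split; nra.
  - rewrite /Num.min /Num.max; move: u0 v0.
    by case: (ltgtP 0 u) => // hu _; case: (ltgtP 0 v) => // hv _;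
      apply/andP; split; nra.
move=> /orP[/and3P[/eqP-> /eqP-> /eqP->]|].
  by exists (1/2), (1/2); split; lra.
pose lo := Num.min 0 u - Num.max 0 v; pose hi := Num.max 0 u - Num.min 0 v.
rewrite -/lo -/hi => /andP[low whi].
pose x := (w - lo) / (hi - lo).
have hl : 0 < hi - lo by lra.
have x01 : 0 < x < 1.
  apply/andP; split; first by rewrite divr_gt0// subr_gt0.
  by rewrite ltr_pdivrMr// mul1r; lra.
have xE : x * (hi - lo) = w - lo by rewrite /x mulfVK// gt_eqF.
move: xE x01; rewrite /lo /hi; move: {low whi hl} x => x xE /andP[x0 x1].
(* With these choices [t * u] and [- s * v] both move monotonically upwards as [x] goes from 0 to 1,
   so their sum is affine in [x] from [lo] to [hi], and it equals [w] at the present [x]. *)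
exists (if 0 <= u then x else 1 - x), (if 0 <= v then 1 - x else x).
move: xE; rewrite /Num.min /Num.max.
by case: (ltgtP 0 u) => hu; case: (ltgtP 0 v) => hv xE; split; nra.
Qed.

(* Quantifier-free form of the crossing of two segments; it is what makes the
   event that a random geometric graph is plane measurable. *)
Definition vector_cross u1 u2 v1 v2 w1 w2 : bool :=
  let D := u2 * v1 - u1 * v2 in
  let t := w2 * v1 - w1 * v2 in
  let s := u1 * w2 - u2 * w1 in
  if D == 0 then
    if (u1 == 0) && (v1 == 0) then (w1 == 0) && interval_cross u2 v2 w2
    else [&& interval_cross u1 v1 w1, u1 * w2 == u2 * w1 & v1 * w2 == v2 * w1]
  else (0 < t * D) && (t * D < D ^+ 2) && ((0 < s * D) && (s * D < D ^+ 2)).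

(** For [D != 0], Cramer's rule gives [t = t0 / D] and [s = s0 / D], and multiplying by [D ^+ 2]
    clears the division whatever the sign of [D]. For [D = 0] the directions are parallel: a
    coordinate in which they do not both vanish decides, and the other one only requires [w] to be
    parallel to them. *)
Lemma vector_crossP u1 u2 v1 v2 w1 w2 :
  (exists t s : R, [/\ 0 < t < 1, 0 < s < 1, t * u1 - s * v1 = w1
                     & t * u2 - s * v2 = w2]) <->
  vector_cross u1 u2 v1 v2 w1 w2.
Proof.
rewrite /vector_cross; set D := u2 * v1 - u1 * v2.
set t0 := w2 * v1 - w1 * v2; set s0 := u1 * w2 - u2 * w1.
have [D0|D0] := eqVneq D 0.
  have [/andP[/eqP u10 /eqP v10]|] := boolP ((u1 == 0) && (v1 == 0)).
    split=> [[t [s [ht hs h1 h2]]]|/andP[/eqP w10] /interval_crossP].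
      apply/andP; split; first by rewrite -h1 u10 v10 !mulr0 subr0.
      by apply/interval_crossP; exists t, s.
    by move=> [t [s [ht hs h]]]; exists t, s; split; rewrite // u10 v10 w10; lra.
  move=> uv; split=> [[t [s [ht hs h1 h2]]]|].
    apply/and3P; split; first by apply/interval_crossP; exists t, s.
      by apply/eqP; rewrite -h1 -h2; move: D0; rewrite /D => D0; nra.
    by apply/eqP; rewrite -h1 -h2; move: D0; rewrite /D => D0; nra.
  move=> /and3P[/interval_crossP[t [s [ht hs h1]]] /eqP e1 /eqP e2].
  exists t, s; split=> //.
  have k1 : u1 * (t * u2 - s * v2) = u1 * w2.
    by rewrite e1 -h1; move: D0; rewrite /D => D0; nra.
  have k2 : v1 * (t * u2 - s * v2) = v1 * w2.
    by rewrite e2 -h1; move: D0; rewrite /D => D0; nra.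
  move: uv; rewrite negb_and => /orP[u10|v10].
    exact: (mulfI u10).
  exact: (mulfI v10).
have D2 : 0 < D ^+ 2 by rewrite lt_neqAle eq_sym expf_neq0//= sqr_ge0.
split=> [[t [s [/andP[tp t1] /andP[sp s1] h1 h2]]]|].
  have -> : t0 = t * D by rewrite /t0 /D -h1 -h2; ring.
  have -> : s0 = s * D by rewrite /s0 /D -h1 -h2; ring.
  rewrite -!mulrA -expr2 !(gtr_pMl _ D2) t1 s1.
  by rewrite (mulr_gt0 tp D2) (mulr_gt0 sp D2).
move=> /andP[/andP[a1 a2] /andP[b1 b2]].
exists (t0 * D / D ^+ 2), (s0 * D / D ^+ 2).
split; [by rewrite divr_gt0//= ltr_pdivrMr// mul1r..| |].
  by rewrite /t0 /s0; rewrite /D in D0 *; field.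
by rewrite /t0 /s0; rewrite /D in D0 *; field.
Qed.

Lemma seg_crossP a b c e : seg_cross a b c e <->
  vector_cross (b.1 - a.1) (b.2 - a.2) (e.1 - c.1) (e.2 - c.2)
               (c.1 - a.1) (c.2 - a.2).
Proof.
rewrite -vector_crossP; split.
  move=> [z [[t [ht ->]] [s [hs [h1 h2]]]]]; exists t, s; split=> //; lra.
move=> [t [s [ht hs h1 h2]]].
exists (a.1 + t * (b.1 - a.1), a.2 + t * (b.2 - a.2)); split; first by exists t.
by exists s; split=> //; congr pair; lra.
Qed.

Lemma open_segC a b : open_seg a b = open_seg b a.
Proof.
by apply/seteqP; split=> z [t [ht ->]]; exists (1 - t);
  (split; [lra|congr pair; ring]).
Qed.

Definition collinear a b c : Prop :=
  (b.1 - a.1) * (c.2 - a.2) = (c.1 - a.1) * (b.2 - a.2).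

(** A common point is [a + t (b - a) = a + s (c - a)] with [t] nonzero, so [b - a] is a multiple of
    [c - a]. *)
Lemma seg_cross_collinear a b c : seg_cross a b a c -> collinear a b c.
Proof.
move=> [z [[t [/andP[t0 _] ->]] [s [_ [h1 h2]]]]].
have t_neq0 : t != 0 by rewrite gt_eqF.
apply: (mulfI t_neq0); rewrite mulrA [RHS]mulrCA.
have -> : t * (b.1 - a.1) = s * (c.1 - a.1) by lra.
have -> : t * (b.2 - a.2) = s * (c.2 - a.2) by lra.
by ring.
Qed.

Lemma edist_coord a b r : edist a b <= r ->
  `|a.1 - b.1| <= r /\ `|a.2 - b.2| <= r.
Proof.
move=> ab; split; apply: le_trans ab; rewrite /edist -sqrtr_sqr ler_wsqrtr//.
  by rewrite lerDl sqr_ge0.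
by rewrite lerDr sqr_ge0.
Qed.

Lemma open_seg_near a b z r : open_seg a b z -> edist a b <= r ->
  [/\ `|a.1 - z.1| <= r, `|a.2 - z.2| <= r, `|b.1 - z.1| <= r
    & `|b.2 - z.2| <= r].
Proof.
move=> [t [/andP[t0 t1] ->]] /edist_coord[/= h1 h2].
move: h1 h2; rewrite !ler_norml => /andP[h1 h2] /andP[h3 h4].
by split; apply/andP; split; nra.
Qed.

(** In each coordinate all four endpoints lie within [r] of the crossing point; the triangle
    inequality doubles this. *)
Lemma seg_cross_near a b c e r :
    edist a b <= r -> edist c e <= r -> seg_cross a b c e ->
  forall p, p = b \/ p = c \/ p = e ->
    `|p.1 - a.1| <= 2 * r /\ `|p.2 - a.2| <= 2 * r.
Proof.
move=> ab ce [z [/open_seg_near-/(_ _ ab)[h1 h2 h3 h4]]].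
move=> /open_seg_near-/(_ _ ce)[h5 h6 h7 h8].
move: h1 h2 h3 h4 h5 h6 h7 h8; rewrite !ler_norml.
move=> /andP[? ?] /andP[? ?] /andP[? ?] /andP[? ?] /andP[? ?] /andP[? ?].
move=> /andP[? ?] /andP[? ?] p [->|[->|->]];
by rewrite !ler_norml; split; apply/andP; split; lra.
Qed.

(* In each coordinate the hypotheses place one segment strictly across the
   strip that contains the other. *)
Lemma seg_cross_strips a b c e (x0 x1 y0 y1 : R) :
  a.1 < x0 -> x0 < c.1 < x1 -> x0 < e.1 < x1 -> x1 < b.1 ->
  c.2 < y0 -> y0 < a.2 < y1 -> y0 < b.2 < y1 -> y1 < e.2 ->
  seg_cross a b c e.
Proof.
case: a b c e => [a1 a2] [b1 b2] [c1 c2] [e1 e2] /=.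
move=> ax /andP[c1l c1r] /andP[e1l e1r] bx cy /andP[a2l a2r] /andP[b2l b2r] ey.
(* With [D] the determinant below, Cramer's rule gives [A1 + A2] as [D t], [B1 + B2] as [D (1 - t)],
   [C1 + C2] as [D s] and [E1 + E2] as [D (1 - s)]. Hence all the required signs follow linearly
   from these products. *)
have A1 : 0 < (c1 - a1) * (e2 - a2) by rewrite mulr_gt0// subr_gt0; lra.
have A2 : 0 < (e1 - a1) * (a2 - c2) by rewrite mulr_gt0// subr_gt0; lra.
have B1 : 0 < (b1 - c1) * (e2 - b2) by rewrite mulr_gt0// subr_gt0; lra.
have B2 : 0 < (b1 - e1) * (b2 - c2) by rewrite mulr_gt0// subr_gt0; lra.
have C1 : 0 < (a2 - c2) * (b1 - c1) by rewrite mulr_gt0// subr_gt0; lra.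
have C2 : 0 < (b2 - c2) * (c1 - a1) by rewrite mulr_gt0// subr_gt0; lra.
have E1 : 0 < (e2 - a2) * (b1 - e1) by rewrite mulr_gt0// subr_gt0; lra.
have E2 : 0 < (e2 - b2) * (e1 - a1) by rewrite mulr_gt0// subr_gt0; lra.
apply/seg_crossP/vector_crossP => /=.
pose D := (b1 - a1) * (e2 - c2) - (b2 - a2) * (e1 - c1).
have D0 : 0 < D by rewrite /D; lra.
have Dn : D != 0 by rewrite gt_eqF.
exists (((c1 - a1) * (e2 - c2) - (c2 - a2) * (e1 - c1)) / D).
exists (((c1 - a1) * (b2 - a2) - (b1 - a1) * (c2 - a2)) / D).
rewrite !ltr_pdivrMr// !ltr_pdivlMr// mul0r mul1r; split.
- by apply/andP; split; rewrite /D; lra.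
- by apply/andP; split; rewrite /D; lra.
- by rewrite /D in Dn *; field.
- by rewrite /D in Dn *; field.
Qed.

Lemma edist_le_box a b r : `|a.1 - b.1| <= r -> `|a.2 - b.2| <= r ->
  edist a b <= 2 * r.
Proof.
move=> h1 h2; have r0 : 0 <= r := le_trans (normr_ge0 _) h1.
rewrite -(@ger0_norm _ (2 * r)) ?mulr_ge0// -sqrtr_sqr ler_wsqrtr//.
rewrite -(real_normK (num_real (a.1 - b.1))) -(real_normK (num_real (a.2 - _))).
have := normr_ge0 (a.1 - b.1); have := normr_ge0 (a.2 - b.2).
by nra.
Qed.

End crossing.

(** * Measurability of the graph events *)

Section measurability.
Context (d : measure_display) (T : measurableType d) (R : realType).
Implicit Types (f g : T -> R).

Lemma measurable_interval_cross f g h :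
  measurable_fun setT f -> measurable_fun setT g -> measurable_fun setT h ->
  measurable_fun setT (fun x => interval_cross (f x) (g x) (h x)).
Proof.
move=> mf mg mh; apply: measurable_or.
  by do ?apply: measurable_and; apply: measurable_fun_eqr.
by apply: measurable_and; apply: measurable_fun_ltr => //;
  apply: measurable_funB; apply: measurable_maxr || apply: measurable_minr.
Qed.

Lemma measurable_vector_cross f1 f2 g1 g2 h1 h2 :
  measurable_fun setT f1 -> measurable_fun setT f2 ->
  measurable_fun setT g1 -> measurable_fun setT g2 ->
  measurable_fun setT h1 -> measurable_fun setT h2 ->
  measurable_fun setT
    (fun x : T => @vector_cross R (f1 x) (f2 x) (g1 x) (g2 x) (h1 x) (h2 x)).
Proof.
move=> mf1 mf2 mg1 mg2 mh1 mh2.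
apply: measurable_fun_ifT.
- by apply: measurable_fun_eqr => //; apply: measurable_funB; apply: measurable_funM.
- apply: measurable_fun_ifT.
  + by apply: measurable_and; apply: measurable_fun_eqr.
  + apply: measurable_and; first exact: measurable_fun_eqr.
    exact: measurable_interval_cross.
  + apply: measurable_and; first exact: measurable_interval_cross.
    by apply: measurable_and; apply: measurable_fun_eqr; apply: measurable_funM.
- by do 2!apply: measurable_and; apply: measurable_fun_ltr => //;
   do ?[apply: measurable_funB|apply: measurable_funM|apply: measurable_funX].
Qed.

Lemma measurable_boolP (f : T -> bool) :
  measurable_fun setT f -> measurable [set x | f x].
Proof.
by move=> mf; have := mf measurableT [set true] I; rewrite setTI.
Qed.

Variable X : nat -> T -> pt R.
Hypothesis mX : forall i, measurable_fun setT (X i).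

Lemma measurable_X1 i : measurable_fun setT (fun w => (X i w).1 : R).
Proof. exact: (measurableT_comp measurable_fst (mX i)). Qed.

Lemma measurable_X2 i : measurable_fun setT (fun w => (X i w).2 : R).
Proof. exact: (measurableT_comp measurable_snd (mX i)). Qed.

Lemma measurable_seg_cross i j k l :
  measurable [set w | seg_cross (X i w) (X j w) (X k w) (X l w)].
Proof.
rewrite (_ : mkset _ = [set w | vector_cross
  ((X j w).1 - (X i w).1) ((X j w).2 - (X i w).2)
  ((X l w).1 - (X k w).1) ((X l w).2 - (X k w).2)
  ((X k w).1 - (X i w).1) ((X k w).2 - (X i w).2)]); last first.
  by apply/seteqP; split=> w /=; rewrite seg_crossP.
apply/measurable_boolP/measurable_vector_cross; apply: measurable_funB;
  exact: measurable_X1 || exact: measurable_X2.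
Qed.

Lemma measurable_edist_le i j r :
  measurable [set w | edist (X i w) (X j w) <= r].
Proof.
(* Squaring the inequality is an equivalence only for [0 <= r]; for negative [r] the event is
   empty. *)
have [r0|r0] := leP 0 r; last first.
  rewrite (_ : mkset _ = set0)//; apply/seteqP; split=> w //=.
  by rewrite leNgt => /negP; apply; apply: lt_le_trans r0 (sqrtr_ge0 _).
rewrite (_ : mkset _ = [set w |
  ((X i w).1 - (X j w).1) ^+ 2 + ((X i w).2 - (X j w).2) ^+ 2 <= r ^+ 2]).
  apply: measurable_boolP; apply: measurable_fun_ler => //.
  by apply: measurable_funD; apply: measurable_funX; apply: measurable_funB;
     exact: measurable_X1 || exact: measurable_X2.
apply/seteqP; split=> w /= h; last first.
  by rewrite -(ger0_norm r0) -sqrtr_sqr ler_wsqrtr.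
rewrite -[leLHS]sqr_sqrtr ?addr_ge0 ?sqr_ge0//.
by rewrite ler_sqr ?nnegrE ?sqrtr_ge0.
Qed.

Lemma measurable_rgg_edge n r i j :
  measurable [set w | rgg_edge (X ^~ w) n r i j].
Proof.
have [h|h] := pselect ((i < n)%N /\ (j < n)%N /\ i <> j); last first.
  by rewrite (_ : mkset _ = set0)//; apply/seteqP; split=> w // [? [? [? ?]]]; apply: h.
rewrite (_ : mkset _ = [set w | edist (X i w) (X j w) <= r]).
  exact: measurable_edist_le.
by move: h => [? [? ?]]; apply/seteqP; split=> w; [case=> ? [? []]|].
Qed.

Lemma measurable_rgg_plane n r : measurable [set w | rgg_plane (X ^~ w) n r].
Proof.
pose F i j k l := [set w | rgg_edge (X ^~ w) n r i j -> rgg_edge (X ^~ w) n r k l ->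
    ~ ((i = k /\ j = l) \/ (i = l /\ j = k)) ->
    ~ seg_cross (X i w) (X j w) (X k w) (X l w)].
rewrite (_ : mkset _ = \bigcap_i \bigcap_j \bigcap_k \bigcap_l F i j k l).
  apply: bigcapT_measurable => i; apply: bigcapT_measurable => j.
  apply: bigcapT_measurable => k; apply: bigcapT_measurable => l.
  have [h|h] := pselect ((i = k /\ j = l) \/ (i = l /\ j = k)).
    by rewrite (_ : F _ _ _ _ = setT)//; apply/seteqP; split=> w // _ ? ? /(_ h).
  rewrite (_ : F _ _ _ _ = ~` ([set w | rgg_edge (X ^~ w) n r i j] `&`
    [set w | rgg_edge (X ^~ w) n r k l] `&`
    [set w | seg_cross (X i w) (X j w) (X k w) (X l w)])).
    apply: measurableC; apply: measurableI; last exact: measurable_seg_cross.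
    by apply: measurableI; exact: measurable_rgg_edge.
  by apply/seteqP; split=> w /= Fw; [move=> [[? ?]]; exact: Fw|
    move=> ? ? _ ?; apply: Fw].
apply/seteqP; split=> w /=.
  by move=> h i _ j _ k _ l _; apply: h.
by move=> h i j k l; apply: h.
Qed.

End measurability.

(** * Real-valued probabilities and the second moment method *)

Section real_probability.
Context (d : measure_display) (T : measurableType d) (R : realType).
Variable P : probability T R.

(** Probabilities as elements of [R] rather than of the extended reals, so that ordered field
    arithmetic applies to them. *)
Definition pr (A : set T) : R := fine (P A).

Lemma prE A : measurable A -> P A = (pr A)%:E.
Proof. by move=> mA; rewrite /pr fineK// fin_num_measure. Qed.

Lemma pr_ge0 A : 0 <= pr A.
Proof. exact: fine_ge0. Qed.

Lemma le_pr A B : measurable A -> measurable B -> A `<=` B -> pr A <= pr B.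
Proof. by move=> mA mB AB; rewrite -lee_fin -!prE// le_measure ?inE. Qed.

Lemma pr_le1 A : measurable A -> pr A <= 1.
Proof. by move=> mA; rewrite -lee_fin -prE// probability_le1. Qed.

Lemma prC A : measurable A -> pr (~` A) = 1 - pr A.
Proof.
move=> mA; apply: EFin_inj; rewrite -prE; last exact: measurableC.
by rewrite probability_setC// prE.
Qed.

Lemma pr_split A B : measurable A -> measurable B ->
  pr A = pr (A `&` B) + pr (A `&` ~` B).
Proof.
move=> mA mB; rewrite addrC; apply: EFin_inj; rewrite EFinD -!prE//.
- by rewrite -setDE; exact: measureDI.
- exact: measurableI.
- by apply: measurableI => //; exact: measurableC.
Qed.

Lemma prU_le A B : measurable A -> measurable B -> pr (A `|` B) <= pr A + pr B.
Proof.
move=> mA mB; rewrite -lee_fin EFinD -!prE ?measureU2//.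
exact: measurableU.
Qed.

Lemma integral_indic_comb (I : Type) (s : seq I) (c : I -> R) (A : I -> set T) :
  (forall i, 0 <= c i) -> (forall i, measurable (A i)) ->
  (\int[P]_x (\sum_(i <- s) c i * \1_(A i) x)%:E)%E =
  (\sum_(i <- s) c i * pr (A i))%:E.
Proof.
move=> c0 mA; rewrite -sumEFin.
under eq_integral do rewrite -sumEFin.
rewrite ge0_integral_sum//; last 2 first.
- move=> i; apply/measurable_EFinP; apply: measurable_funM => //.
- by move=> i x _; rewrite lee_fin mulr_ge0.
apply: eq_bigr => i _; under eq_integral do rewrite EFinM.
rewrite ge0_integralZl ?lee_fin//.
  by rewrite integral_indic// setIT EFinM -prE.
by apply/measurable_EFinP; exact: measurable_indic.
Qed.

(** Monotonicity of the integral: a pointwise inequality between combinations of indicators passes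
    to probabilities. *)
Lemma le_indic_comb (I J : Type) (s : seq I) (s' : seq J) (c : I -> R)
    (c' : J -> R) (A : I -> set T) (B : J -> set T) :
  (forall i, 0 <= c i) -> (forall j, 0 <= c' j) ->
  (forall i, measurable (A i)) -> (forall j, measurable (B j)) ->
  (forall x, \sum_(i <- s) c i * \1_(A i) x <= \sum_(j <- s') c' j * \1_(B j) x) ->
  \sum_(i <- s) c i * pr (A i) <= \sum_(j <- s') c' j * pr (B j).
Proof.
move=> c0 c'0 mA mB AB; rewrite -lee_fin -!integral_indic_comb//.
apply: ge0_le_integral => //.
- by move=> x _; rewrite lee_fin sumr_ge0// => i _; rewrite mulr_ge0.
- apply/measurable_EFinP; apply: measurable_sum => i.
  by apply: measurable_funM.
- apply/measurable_EFinP; apply: measurable_sum => i.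
  by apply: measurable_funM.
- by move=> x _; rewrite lee_fin.
Qed.

Lemma measurable_big_setU (I : Type) (s : seq I) (A : I -> set T) :
  (forall i, measurable (A i)) -> measurable (\big[setU/set0]_(i <- s) A i).
Proof. by move=> mA; apply: bigsetU_measurable. Qed.

Lemma pr_union_le (I : Type) (s : seq I) (A : I -> set T) :
  (forall i, measurable (A i)) ->
  pr (\big[setU/set0]_(i <- s) A i) <= \sum_(i <- s) pr (A i).
Proof.
move=> mA; elim: s => [|i s IH]; first by rewrite !big_nil /pr measure0.
rewrite !big_cons; apply: le_trans (lerD (lexx _) IH).
by apply: prU_le => //; exact: measurable_big_setU.
Qed.

(* Integrate [2 l Z <= 1_{Z > 0} + l^2 Z^2], where [Z] counts the events that
   occur and [l] is the inverse of the mean of [Z]. *)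
Lemma second_moment (I : Type) (s : seq I) (A : I -> set T) :
    (forall i, measurable (A i)) ->
    let mu := \sum_(i <- s) pr (A i) in
    0 < mu ->
    \sum_(i <- s) \sum_(j <- s) pr (A i `&` A j) <= mu + mu ^+ 2 ->
  1 - mu^-1 <= pr (\big[setU/set0]_(i <- s) A i).
Proof.
move=> mA mu mu0 le2.
set U := \big[setU/set0]_(i <- s) A i.
have mU : measurable U by exact: measurable_big_setU.
pose l := mu^-1; have l0 : 0 <= l by rewrite invr_ge0 ltW.
(* The right side has one term for the union, indexed by [None], and one for each pair of events,
   together expanding [l ^+ 2 * Z ^+ 2]. *)
pose B (k : option (I * I)) := if k is Some (i, j) then A i `&` A j else U.
pose c (k : option (I * I)) := if k is Some _ then l ^+ 2 else 1 : R.
pose s2 := None :: [seq Some (i, j) | i <- s, j <- s].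
have sumE (F : option (I * I) -> R) : \sum_(k <- s2) F k =
    F None + \sum_(i <- s) \sum_(j <- s) F (Some (i, j)).
  by rewrite big_cons big_allpairs_dep.
have : \sum_(i <- s) (2 * l) * pr (A i) <= \sum_(k <- s2) c k * pr (B k).
  apply: le_indic_comb => //.
  - by move=> _; rewrite mulr_ge0.
  - by case=> [?|] /=; rewrite ?exprn_ge0.
  - by case=> [[i j]|]//=; exact: measurableI.
  move=> x; rewrite sumE /= mul1r.
  pose Z : R := \sum_(i <- s) \1_(A i) x.
  have -> : \sum_(i <- s) 2 * l * \1_(A i) x = 2 * l * Z by rewrite mulr_sumr.
  have -> : \sum_(i <- s) \sum_(j <- s) l ^+ 2 * \1_(A i `&` A j) x = (l * Z) ^+ 2.
    rewrite exprMn [Z ^+ 2]expr2 mulr_suml mulr_sumr; apply: eq_bigr => i _.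
    rewrite mulr_sumr mulr_sumr; apply: eq_bigr => j _.
    by rewrite indicI.
  have [xU|xU] := pselect (U x).
    rewrite indicE mem_set//=; have := sqr_ge0 (l * Z - 1); nra.
  have -> : Z = 0.
    rewrite /Z; move: xU; rewrite /U; elim: (s) => [|i s' IH]; first by rewrite !big_nil.
    rewrite !big_cons => /not_orP[h1 h2]; rewrite IH// addr0 indicE memNset//.
  by rewrite !mulr0 expr0n addr0.
rewrite sumE /= mul1r -mulr_sumr -/mu.
under eq_bigr do rewrite -mulr_sumr.
rewrite -mulr_sumr => h.
(* Since [l * mu = 1], the integrated inequality becomes [2 <= pr U + l + 1]. *)
have lmu : l * mu = 1 by rewrite /l mulVf// gt_eqF.
have l2 : l ^+ 2 * (mu + mu ^+ 2) = l + 1.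
  by rewrite mulrDr -exprMn lmu expr1n expr2 -mulrA lmu mulr1.
have := ler_wpM2l (exprn_ge0 2 l0) le2; rewrite l2 -/l => h2.
have : 2 * l * mu = 2 by rewrite -mulrA lmu mulr1.
by lra.
Qed.

End real_probability.

(** * Independent uniform points and disjoint blocks of indices *)

Section random_points.
Context (d : measure_display) (T : measurableType d) (R : realType).
Variables (P : probability T R) (X : nat -> T -> pt R).
Hypothesis mX : forall i, measurable_fun setT (X i).
Hypothesis X_indep : iid_indep P X.
Hypothesis X_unif : forall i, unif_square P (X i).
Local Notation pr := (pr P).

Lemma measurable_preX i (A : set (pt R)) : measurable A ->
  measurable (X i @^-1` A).
Proof. by move=> mA; have := mX i measurableT mA; rewrite setTI. Qed.

Lemma measurable_big_preX (s : seq nat) (A : nat -> set (pt R)) :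
  (forall i, measurable (A i)) ->
  measurable (\big[setI/setT]_(i <- s) X i @^-1` A i).
Proof.
by move=> mA; elim/big_ind: _ => // [? ? ? ?|i _];
  [exact: measurableI|exact: measurable_preX].
Qed.

Lemma pr_indep (s : seq nat) (A : nat -> set (pt R)) :
  uniq s -> (forall i, measurable (A i)) ->
  pr (\big[setI/setT]_(i <- s) X i @^-1` A i) =
  \prod_(i <- s) pr (X i @^-1` A i).
Proof.
move=> us mA; apply: EFin_inj; rewrite -prE; last exact: measurable_big_preX.
rewrite X_indep// -prodEFin; apply: eq_bigr => i _.
by rewrite prE//; exact: measurable_preX.
Qed.

(** Only an upper bound, since the rectangle may stick out of the unit square, as enlarged grid
    cells at the border do. *)
Lemma pr_unif_le i (I J : interval R) (x y : R) :
  lebesgue_measure [set` I] = x%:E -> lebesgue_measure [set` J] = y%:E ->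
  pr (X i @^-1` ([set` I] `*` [set` J])) <= x * y.
Proof.
move=> hI hJ.
have mIJ : measurable ([set` I] `*` [set` J] : set (pt R)) by exact: measurableX.
rewrite -lee_fin -prE; last exact: measurable_preX.
rewrite X_unif// EFinM -hI -hJ -product_measure1E//.
apply: le_measure; rewrite ?inE//; first by apply: measurableI => //; exact: measurableX.
Qed.

Lemma pr_unif i (I J : interval R) (x y : R) :
  [set` I] `<=` `[0, 1] -> [set` J] `<=` `[0, 1] ->
  lebesgue_measure [set` I] = x%:E -> lebesgue_measure [set` J] = y%:E ->
  pr (X i @^-1` ([set` I] `*` [set` J])) = x * y.
Proof.
move=> I01 J01 hI hJ.
have mIJ : measurable ([set` I] `*` [set` J] : set (pt R)) by exact: measurableX.
apply: EFin_inj; rewrite -prE; last exact: measurable_preX.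
rewrite X_unif// EFinM -hI -hJ -product_measure1E//; congr (_ _).
by apply/setIidPl => -[u v] [/= hu hv]; split; [exact: I01|exact: J01].
Qed.

Lemma pr_outside i : pr (X i @^-1` (~` (`[0, 1] `*` `[0, 1]))) = 0.
Proof.
have mQ : measurable (`[0, 1] `*` `[0, 1] : set (pt R)) by exact: measurableX.
apply: EFin_inj; rewrite -prE; last by apply/measurable_preX/measurableC.
by rewrite X_unif ?setICl ?measure0//; exact: measurableC.
Qed.

Lemma pr_setI2C (G A B : set T) : measurable G -> measurable A -> measurable B ->
  pr (G `&` (~` A `&` ~` B)) =
  pr G - pr (G `&` A) - pr (G `&` B) + pr (G `&` (A `&` B)).
Proof.
move=> mG mA mB.
have mCA := measurableC mA.
have e1 := pr_split P mG mA.
have e2 := pr_split P (measurableI _ _ mG mCA) mB.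
have e3 := pr_split P (measurableI _ _ mG mB) mA.
rewrite setIA; rewrite -!setIA in e2 e3 *.
rewrite [B `&` ~` A]setIC [B `&` A]setIC in e3.
by lra.
Qed.

(** Avoidance is an intersection of events about single points, so independence applies to it
    directly; hitting [A] is its complement. *)
Definition avoid (s : seq nat) (A : set (pt R)) : set T :=
  \big[setI/setT]_(i <- s) X i @^-1` (~` A).

Lemma measurable_avoid s A : measurable A -> measurable (avoid s A).
Proof. by move=> mA; apply: measurable_big_preX => _; exact: measurableC. Qed.

Lemma avoidI s A B : avoid s A `&` avoid s B = avoid s (A `|` B).
Proof.
rewrite /avoid -big_split; apply: eq_bigr => i _ /=.
by rewrite -preimage_setI setCU.
Qed.

Lemma not_avoid s A w : ~ avoid s A w -> exists2 i, i \in s & A (X i w).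
Proof.
rewrite /avoid; elim: s => [|i s IH]; first by rewrite big_nil => /(_ I).
rewrite big_cons => /not_andP[/contrapT h|/IH[j js h]].
  by exists i => //; rewrite mem_head.
by exists j => //; rewrite inE js orbT.
Qed.

Lemma pr_avoid s A p : uniq s -> measurable A ->
  (forall i, pr (X i @^-1` A) = p) -> pr (avoid s A) = (1 - p) ^+ size s.
Proof.
move=> us mA hp; rewrite /avoid pr_indep//; last by move=> _; exact: measurableC.
rewrite (eq_bigr (fun=> 1 - p)) => [|i _].
  by rewrite big_const_seq count_predT iter_mulr_1.
by rewrite preimage_setC prC ?hp//; exact: measurable_preX.
Qed.

(* Inclusion-exclusion over the last block trades its complemented events for
   events of the product form, to which the induction hypothesis applies. *)
Lemma pr_blocks (m k : nat) (A B : nat -> set (pt R)) (s : seq nat)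
    (C : nat -> set (pt R)) :
  let E g := ~` avoid (iota (g * m) m) (A g) `&`
             ~` avoid (iota (g * m) m) (B g) in
  (forall g, measurable (A g)) -> (forall g, measurable (B g)) ->
  (forall i, measurable (C i)) ->
  uniq s -> (forall i, i \in s -> (k * m <= i)%N) ->
  pr (\big[setI/setT]_(g < k) E g `&` \big[setI/setT]_(i <- s) X i @^-1` C i) =
  \prod_(g < k) pr (E g) * pr (\big[setI/setT]_(i <- s) X i @^-1` C i).
Proof.
move=> E mA mB; have mE g : measurable (E g).
  by apply: measurableI; apply/measurableC/measurable_avoid.
have mF n : measurable (\big[setI/setT]_(g < n) E g).
  by elim/big_ind: _ => // ? ? ? ?; exact: measurableI.
elim: k s C => [|k IH] s C mC us sk; first by rewrite !big_ord0 setTI mul1r.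
rewrite !big_ord_recr /=; set F := \big[setI/setT]_(g < k) _.
set S := \big[setI/setT]_(i <- s) _; set p := \prod_(g < k) _.
have mS : measurable S by exact: measurable_big_preX.
pose t := iota (k * m) m.
have kt i : i \in t -> (k * m <= i < k.+1 * m)%N.
  by rewrite mem_iota mulSn addnC.
have dis i : i \in s -> i \notin t.
  by move=> /sk h; apply/negP => /kt /andP[_]; rewrite ltnNge h.
have IH1 : pr (F `&` S) = p * pr S.
  by apply: IH => // i /sk; apply: leq_trans; rewrite leq_mul2r leqnSn orbT.
have IH2 D : measurable D -> pr ((F `&` S) `&` avoid t D) = p * pr S * pr (avoid t D).
  (* The requirement that block [k] avoids [D] is absorbed into the product event, by extending the
     prescribed sets from [s] to [s ++ t]. *)
  move=> mD; pose C' i := if i \in t then ~` D else C i.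
  have mC' i : measurable (C' i).
    by rewrite /C'; case: ifP => _ //; exact: measurableC.
  have ust : uniq (s ++ t).
    rewrite cat_uniq us iota_uniq andbT /=; apply/hasPn => i it.
    by apply/negP => /dis; rewrite it.
  have eS : \big[setI/setT]_(i <- s) X i @^-1` C' i = S.
    by apply: eq_big_seq => i /dis it; rewrite /C' (negbTE it).
  have eD : \big[setI/setT]_(i <- t) X i @^-1` C' i = avoid t D.
    by apply: eq_big_seq => i it; rewrite /C' it.
  have := IH (s ++ t) C' mC' ust; rewrite big_cat /= eS eD -setIA => ->.
    rewrite -mulrA; congr (_ * _).
    have := pr_indep ust mC'; rewrite !big_cat /= eS eD => ->.
    by rewrite -!pr_indep ?eS ?eD// iota_uniq.
  move=> i; rewrite mem_cat => /orP[/sk|/kt/andP[]//].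
  by apply: leq_trans; rewrite leq_mul2r leqnSn orbT.
rewrite setIAC /E -/t.
have mAk : measurable (avoid t (A k)) by exact: measurable_avoid.
have mBk : measurable (avoid t (B k)) by exact: measurable_avoid.
have mFS : measurable (F `&` S) by apply: measurableI => //; exact: mF.
rewrite pr_setI2C// avoidI.
have mAB : measurable (A k `|` B k) by exact: measurableU.
rewrite IH1 !IH2//.
rewrite -[~` _ `&` ~` _]setTI pr_setI2C// !setTI avoidI.
have -> : pr setT = 1 by rewrite /pr probability_setT.
by ring.
Qed.

(** * The number of occupied cells *)

Section cells.
Variables (I : eqType) (S : I -> nat -> set (pt R)) (m : nat) (p : R).
Hypothesis mS : forall c g, measurable (S c g).
Hypothesis pS : forall c g i, pr (X i @^-1` S c g) = p.
Hypothesis dS : forall c c' g, c != c' -> S c g `&` S c' g = set0.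

Definition occupied c : set T :=
  \big[setI/setT]_(g < 4) ~` avoid (iota (g * m) m) (S c g).

Let q := 1 - (1 - p) ^+ m.

Lemma measurable_occupied c : measurable (occupied c).
Proof.
rewrite /occupied; elim/big_ind: _ => // [? ? ? ?|i _]; first exact: measurableI.
by apply/measurableC/measurable_avoid.
Qed.

Lemma pr_occupied c : pr (occupied c) = q ^+ 4.
Proof.
(* Each event is doubled so that [pr_blocks], which has two targets per block, applies with equal
   targets. *)
have -> : occupied c = \big[setI/setT]_(g < 4)
    (~` avoid (iota (g * m) m) (S c g) `&` ~` avoid (iota (g * m) m) (S c g)).
  by apply: eq_bigr => g _; rewrite setIid.
have := @pr_blocks m 4 (S c) (S c) [::] (fun=> setT) (mS c) (mS c)
  (fun=> measurableT) isT.
rewrite big_nil !setIT => -> //.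
have -> : pr setT = 1 by rewrite /pr probability_setT.
rewrite mulr1 (eq_bigr (fun=> q)) ?prodr_const ?card_ord// => g _.
rewrite setIid prC; last exact: measurable_avoid.
by rewrite (@pr_avoid _ _ p) ?iota_uniq ?size_iota.
Qed.

(** The blocks are independent, and one block hits two disjoint targets with probability
    [1 - 2 (1 - p)^m + (1 - 2p)^m]. This is at most [q ^+ 2] because [1 - 2p <= (1 - p)^2]; the
    bound on [p] keeps [1 - 2p] nonnegative, so that powers preserve the inequality. *)
Lemma pr_occupied2 c c' : p <= 1 / 2 -> c != c' ->
  pr (occupied c `&` occupied c') <= q ^+ 4 * q ^+ 4.
Proof.
move=> p2 cc.
have := @pr_blocks m 4 (S c) (S c') [::] (fun=> setT) (mS c) (mS c')
  (fun=> measurableT) isT.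
rewrite big_nil !setIT big_split /= => -> //.
have -> : pr setT = 1 by rewrite /pr probability_setT.
rewrite mulr1 -exprMn.
rewrite -[4%N in leRHS]card_ord -prodr_const; apply: ler_prod => g _.
rewrite pr_ge0 /= -[X in pr X]setTI pr_setI2C//; [|exact: measurable_avoid..].
rewrite !setTI avoidI.
have -> : pr setT = 1 by rewrite /pr probability_setT.
rewrite (@pr_avoid _ (S c g) p) ?iota_uniq// (@pr_avoid _ (S c' g) p) ?iota_uniq//.
rewrite (@pr_avoid _ _ (p + p)) ?iota_uniq//; last 2 first.
- exact: measurableU.
- move=> i; rewrite preimage_setU; apply: EFin_inj.
  have mc := measurable_preX i (mS c g); have mc' := measurable_preX i (mS c' g).
  rewrite -prE; last exact: measurableU.
  rewrite (measureU P mc mc').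
    by rewrite -{1}(pS c g i) -(pS c' g i) EFinD -!prE.
  by rewrite -preimage_setI dS// preimage_set0.
have le1 : (1 - (p + p)) ^+ m <= ((1 - p) ^+ m) ^+ 2.
  rewrite -exprM mulnC exprM; apply: lerXn2r; rewrite ?nnegrE ?sqr_ge0//.
    lra.
  by have := sqr_ge0 p; nra.
by rewrite size_iota /q; nra.
Qed.

(** In the second moment the diagonal contributes [mu], and the remaining pairs at most [mu ^+ 2] by
    negative correlation. *)
Lemma pr_some_occupied (s : seq I) : uniq s -> p <= 1 / 2 ->
  let mu := (size s)%:R * q ^+ 4 in 0 < mu ->
  1 - mu^-1 <= pr (\big[setU/set0]_(c <- s) occupied c).
Proof.
move=> us p2 mu mu0.
have muE : \sum_(c <- s) pr (occupied c) = mu.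
  rewrite (eq_bigr (fun=> q ^+ 4)) => [|c _]; last exact: pr_occupied.
  by rewrite big_const_seq count_predT iter_addr_0 -mulr_natl.
rewrite -muE; apply: second_moment; rewrite ?muE//.
  exact: measurable_occupied.
have q4 : 0 <= q ^+ 4 by rewrite exprn_even_ge0.
apply: (@le_trans _ _ (\sum_(c <- s) (q ^+ 4 + (size s)%:R * (q ^+ 4 * q ^+ 4)))).
  rewrite big_seq [leRHS]big_seq; apply: ler_sum => c cs.
  rewrite (bigD1_seq c)//= setIid pr_occupied lerD2l.
  apply: (@le_trans _ _ (\sum_(i <- s) (q ^+ 4 * q ^+ 4))).
    rewrite big_mkcond; apply: ler_sum => c' _.
    case: ifPn => [cc'|_]; last by rewrite mulr_ge0.
    by apply: pr_occupied2; rewrite // eq_sym.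
  by rewrite big_const_seq count_predT iter_addr_0 mulr_natl.
rewrite big_const_seq count_predT iter_addr_0 -[leLHS]mulr_natl mulrDr -/mu lerD2l.
by rewrite /mu exprMn expr2 [(q ^+ 4) ^+ 2]expr2 mulrA.
Qed.

End cells.

End random_points.

(** * Fubini for a pair of independent variables *)

Section independent_pair.
Local Open Scope ereal_scope.
Context d d1 d2 (T : measurableType d) (T1 : measurableType d1)
  (T2 : measurableType d2) (R : realType).
Variables (P : probability T R) (U : T -> T1) (V : T -> T2).
Hypotheses (mU : measurable_fun setT U) (mV : measurable_fun setT V).
Hypothesis UV_indep : forall A B, measurable A -> measurable B ->
  P (U @^-1` A `&` V @^-1` B) = P (U @^-1` A) * P (V @^-1` B).

(** By uniqueness of the product measure, the joint law of [U] and [V] is the product of their laws.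
    The mass of [N] is then the integral of the masses of its sections, all zero. *)
Lemma indep_pair_null (N : set (T1 * T2)) : measurable N ->
  (forall u, P (V @^-1` xsection N u) = 0) ->
  P [set w | N (U w, V w)] = 0.
Proof.
move=> mN N0.
have mUV : measurable_fun setT (fun w => (U w, V w)) by exact: measurable_fun_pair.
pose m1 := giry_map mU P; pose m2 := giry_map mV P; pose m' := giry_map mUV P.
have <- : (m1 \x m2) N = P [set w | N (U w, V w)].
  apply: (@product_measure_unique _ _ _ _ _ m1 m2 m') mN => A B mA mB.
  exact: (UV_indep mA mB).
by apply: integral0_eq => u _; exact: N0.
Qed.

End independent_pair.

(** * Three random points are almost surely not collinear *)

Section collinear_null.
Context (d : measure_display) (T : measurableType d) (R : realType).
Variables (P : probability T R) (X : nat -> T -> pt R).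
Hypothesis mX : forall i, measurable_fun setT (X i).
Hypothesis X_indep : iid_indep P X.
Hypothesis X_unif : forall i, unif_square P (X i).
Local Open Scope ereal_scope.

Lemma indep2 i j (A B : set (pt R)) : i != j -> measurable A -> measurable B ->
  P (X i @^-1` A `&` X j @^-1` B) = P (X i @^-1` A) * P (X j @^-1` B).
Proof.
move=> ij mA mB; pose C k := if k == i then A else B.
have := @X_indep [:: i; j] C; rewrite !big_cons !big_nil setIT mule1 /C eqxx.
rewrite eq_sym (negbTE ij); apply=> [|k]; last by case: ifP.
by rewrite /= inE ij.
Qed.

Lemma indep3 i j k (A B C : set (pt R)) : uniq [:: i; j; k] ->
  measurable A -> measurable B -> measurable C ->
  P (X i @^-1` A `&` X j @^-1` B `&` X k @^-1` C) =
  P (X i @^-1` A) * P (X j @^-1` B) * P (X k @^-1` C).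
Proof.
move=> u mA mB mC; pose D l := if l == i then A else if l == j then B else C.
have := @X_indep [:: i; j; k] D u.
move: u; rewrite /= !inE negb_or andbT => /andP[/andP[ij ik] jk].
rewrite !big_cons !big_nil setIT mule1 /D !eqxx (eq_sym j i) (eq_sym k i) (eq_sym k j).
rewrite (negbTE ij) (negbTE ik) (negbTE jk) setIA muleA; apply=> l.
by case: ifP => // _; case: ifP.
Qed.

(** Dynkin's argument: the sets [A] for which the formula holds form a Dynkin system, and it
    contains the rectangles by independence of three points. *)
Lemma indep_pair_point i j k (A : set (pt R * pt R)) (B : set (pt R)) :
  uniq [:: i; j; k] -> measurable A -> measurable B ->
  P ((fun w => (X i w, X j w)) @^-1` A `&` X k @^-1` B) =
  P ((fun w => (X i w, X j w)) @^-1` A) * P (X k @^-1` B).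
Proof.
move=> u mA mB; set W := fun w => _.
have mW : measurable_fun setT W by exact: measurable_fun_pair.
have mWp D : measurable D -> measurable (W @^-1` D).
  by move=> mD; have := mW measurableT _ mD; rewrite setTI.
have mVB : measurable (X k @^-1` B) by exact: measurable_preX.
move: A mA; rewrite measurable_prod_measurableType.
apply: dynkin_induction.
- exact: measurable_prod_measurableType.
- move=> _ _ [A1 mA1 [A2 mA2 <-]] [B1 mB1 [B2 mB2 <-]].
  exists (A1 `&` B1); first exact: measurableI.
  by exists (A2 `&` B2); [exact: measurableI|rewrite setXI].
- by rewrite preimage_setT setTI probability_setT mul1e.
- move=> _ [A1 mA1 [A2 mA2 <-]].
  have -> : W @^-1` (A1 `*` A2) = X i @^-1` A1 `&` X j @^-1` A2 by [].
  rewrite indep3// indep2//.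
  by move: u; rewrite /= !inE negb_or => /andP[/andP[]].
- move=> D mD hD; rewrite preimage_setC.
  have mWD := mWp _ mD; have mWDC := measurableC mWD.
  have mI := measurableI _ _ mWD mVB; have mIC := measurableI _ _ mWDC mVB.
  move: hD; rewrite !(prE P) // -!EFinM => -[hD]; congr EFin.
  have := pr_split P mVB mWD; rewrite prC// ![X k @^-1` B `&` _]setIC hD.
  by lra.
- move=> F mF tF hF; rewrite preimage_bigcup setI_bigcupl.
  have tWF : trivIset setT (fun n => W @^-1` F n).
    apply/trivIsetP => a b _ _ ab; rewrite -preimage_setI.
    by move/trivIsetP : tF => ->//; rewrite preimage_set0.
  rewrite !measure_bigcup//.
  + rewrite [RHS]muleC [X in X * _](prE P mVB) -nneseriesZl//.
    by apply: eq_eseriesr => n _; rewrite -prE// muleC; exact: hF.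
  + by move=> n _; exact: mWp.
  + by move=> n _; apply: measurableI => //; exact: mWp.
  + apply/trivIsetP => a b _ _ ab; rewrite setIACA setIid.
    by move/trivIsetP : tWF => ->//; rewrite set0I.
Qed.

(** Given one point, the other would have to lie on a fixed vertical line. This case is split off
    because the line through two points of equal abscissa is not the graph of a function. *)
Lemma same_abscissa_null i j : i != j ->
  P [set w | (X i w).1 = (X j w).1] = 0.
Proof.
move=> ij.
pose N : set (pt R * pt R) := [set z | z.1.1 == z.2.1 :> R].
have mN : measurable N.
  by apply/measurable_boolP/measurable_fun_eqr; apply: (measurableT_comp measurable_fst).
have -> : [set w | (X i w).1 = (X j w).1] = [set w | N (X i w, X j w)].
  by apply/seteqP; split=> w /= /eqP.
apply: (@indep_pair_null _ _ _ _ _ _ _ P (X i) (X j)) => //.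
  by move=> A B mA mB; exact: indep2.
move=> z.
have -> : xsection N z = [set z.1] `*` setT.
  apply/seteqP; split=> x; rewrite /xsection /= inE /N /=; first by move=> /eqP ->.
  by move=> [/= -> _].
rewrite X_unif; last exact: measurableX.
rewrite -setXI setTI product_measure1E//; last exact: measurableI.
have mz : measurable ([set z.1] `&` `[0%R, 1%R] : set (measurableTypeR R)).
  exact: measurableI.
have z0 := subset_measure0 mz (measurable_set1 z.1) (@subIsetl _ _ _)
  (lebesgue_measure_set1 z.1).
by rewrite [X in X * _]z0 mul0e.
Qed.

Lemma measurable_collinear i j k :
  measurable [set w | collinear (X i w) (X j w) (X k w)].
Proof.
rewrite (_ : mkset _ = [set w |
  ((X j w).1 - (X i w).1) * ((X k w).2 - (X i w).2) ==
  ((X k w).1 - (X i w).1) * ((X j w).2 - (X i w).2)]%R).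
  apply/measurable_boolP/measurable_fun_eqr; apply: measurable_funM;
  by apply: measurable_funB; exact: measurable_X1 || exact: measurable_X2.
by apply/seteqP; split=> w /eqP.
Qed.

Lemma collinear_null i j k : uniq [:: i; j; k] ->
  P [set w | collinear (X i w) (X j w) (X k w)] = 0.
Proof.
move=> u; have ij : i != j by move: u; rewrite /= !inE negb_or => /andP[/andP[]].
(* Collinear triples whose first two points have distinct abscissas; for these the ordinate of the
   third point is determined by its abscissa. *)
pose N : set ((pt R * pt R) * pt R) := [set z |
  ((z.1.1.1 : R) != z.1.2.1) &&
  (((z.1.2.1 : R) - z.1.1.1) * ((z.2.2 : R) - z.1.1.2) ==
   ((z.2.1 : R) - z.1.1.1) * ((z.1.2.2 : R) - z.1.1.2))]%R.
have m11 : measurable_fun [set: (pt R * pt R) * pt R] (fun z => z.1.1).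
  exact: (measurableT_comp measurable_fst measurable_fst).
have m12 : measurable_fun [set: (pt R * pt R) * pt R] (fun z => z.1.2).
  exact: (measurableT_comp measurable_snd measurable_fst).
have mN : measurable N.
  apply/measurable_boolP/measurable_and.
    apply/measurable_neg/measurable_fun_eqr; exact: (measurableT_comp measurable_fst).
  by apply: measurable_fun_eqr; apply: measurable_funM; apply: measurable_funB;
    exact: (measurableT_comp measurable_fst) || exact: (measurableT_comp measurable_snd).
have N0 : P [set w | N ((X i w, X j w), X k w)] = 0.
  apply: (@indep_pair_null _ _ _ _ _ _ _ P (fun w => (X i w, X j w)) (X k)) => //.
  - exact: measurable_fun_pair.
  - by move=> A B mA mB; exact: indep_pair_point.
  move=> z; rewrite X_unif; last exact: measurable_xsection.
  have mQ : measurable (`[0%R, 1%R] `*` `[0%R, 1%R] : set (pt R)) by exact: measurableX.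
  apply: (subset_measure0 _ _ (@subIsetl _ _ _)).
  - by apply: measurableI => //; exact: measurable_xsection.
  - exact: measurable_xsection.
  (* The area of a section is the integral over [x] of the lengths of its vertical slices; each
     slice is empty or contained in the single point [y0] of the line above [x]. *)
  apply: integral0_eq => x _ /=.
  have [zz|zz] := eqVneq (z.1.1 : R) z.2.1.
    rewrite (_ : xsection _ _ = set0) ?measure0//; apply/seteqP; split=> y //.
    by move=> /set_mem/set_mem; rewrite /N /= zz eqxx.
  pose y0 : R := (z.1.2 + (x - z.1.1) * (z.2.2 - z.1.2) / (z.2.1 - z.1.1))%R.
  have mNx : measurable (xsection (xsection N z) x).
    exact/measurable_xsection/measurable_xsection.
  have sub : xsection (xsection N z) x `<=` [set y0].
    move=> y /set_mem/set_mem; rewrite /N /= zz /= => /eqP h.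
    have dz : (z.2.1 - z.1.1 != 0 :> R)%R by rewrite subr_eq0 eq_sym.
    by rewrite /y0 -h mulrAC mulfV// mul1r addrC subrK.
  exact: (subset_measure0 mNx (measurable_set1 y0) sub (lebesgue_measure_set1 y0)).
have mS : measurable [set w | (X i w).1 = (X j w).1].
  rewrite (_ : mkset _ = [set w | (X i w).1 == (X j w).1 :> R]).
    by apply/measurable_boolP/measurable_fun_eqr; exact: measurable_X1.
  by apply/seteqP; split=> w /eqP.
have mNW : measurable [set w | N ((X i w, X j w), X k w)].
  have mW : measurable_fun setT (fun w => ((X i w, X j w), X k w)).
    by do 2!apply: measurable_fun_pair => //.
  by have := mW measurableT _ mN; rewrite setTI.
have mC := measurable_collinear i j k.
apply: (subset_measure0 mC (measurableU _ _ mS mNW)).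
  move=> w /= h; have [e|e] := eqVneq ((X i w).1 : R) (X j w).1; [by left|right].
  by rewrite /N /= e; apply/eqP.
by apply: null_set_setU => //; exact: same_abscissa_null.
Qed.

End collinear_null.

(** * Above the threshold: an occupied cell forces a crossing *)

Section lower_bound.
Context (d : measure_display) (T : measurableType d) (R : realType).
Variables (P : probability T R) (X : nat -> T -> pt R).
Hypothesis mX : forall i, measurable_fun setT (X i).
Hypothesis X_indep : iid_indep P X.
Hypothesis X_unif : forall i, unif_square P (X i).
Local Notation pr := (pr P).

(** Open squares, so that distinct ones are disjoint and the strict inequalities of
    [seg_cross_strips] hold. *)
Definition subsquare (M a b : nat) : set (pt R) :=
  `]a%:R / M%:R, a.+1%:R / M%:R[ `*` `]b%:R / M%:R, b.+1%:R / M%:R[.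

Lemma subsquareP M a b z : subsquare M a b z ->
  (a%:R / M%:R < z.1 < a.+1%:R / M%:R) /\ (b%:R / M%:R < z.2 < b.+1%:R / M%:R).
Proof. by rewrite /subsquare => -[/=]; rewrite !in_itv. Qed.

Lemma measurable_subsquare M a b : measurable (subsquare M a b).
Proof. exact: measurableX. Qed.

Lemma pr_subsquare i M a b : (0 < M)%N -> (a < M)%N -> (b < M)%N ->
  pr (X i @^-1` subsquare M a b) = M%:R^-1 * M%:R^-1.
Proof.
move=> M0 aM bM.
have M0' : 0 < M%:R :> R by rewrite ltr0n.
have sub k : (k < M)%N -> `]k%:R / M%:R, k.+1%:R / M%:R[ `<=` `[0, 1 : R].
  move=> kM x; rewrite /= !in_itv /= => /andP[/ltW h1 /ltW h2].
  rewrite (le_trans _ h1) ?divr_ge0//= (le_trans h2)// ler_pdivrMr// mul1r.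
  by rewrite ler_nat.
have len (k : nat) :
    lebesgue_measure (`]k%:R / M%:R, k.+1%:R / M%:R[ : set R) = (M%:R^-1)%:E.
  rewrite lebesgue_measure_itv /= lte_fin ltr_pM2r ?invr_gt0// ltr_nat ltnSn.
  by rewrite -EFinB -mulrBl -natr1 addrAC subrr add0r mul1r.
by rewrite /subsquare (pr_unif mX X_unif i (sub _ aM) (sub _ bM) (len _) (len _)).
Qed.

Lemma subsquare_inj M a b a' b' z : (0 < M)%N ->
  subsquare M a b z -> subsquare M a' b' z -> a = a' /\ b = b'.
Proof.
move=> M0; have M0' : 0 < M%:R^-1 :> R by rewrite invr_gt0 ltr0n.
have H (k l : nat) (x : R) : k%:R / M%:R < x < k.+1%:R / M%:R ->
    l%:R / M%:R < x < l.+1%:R / M%:R -> (k <= l)%N.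
  move=> /andP[h1 _] /andP[_ h2]; have := lt_trans h1 h2.
  by rewrite ltr_pM2r// ltr_nat ltnS.
move=> /subsquareP[h1 h2] /subsquareP[h3 h4].
by split; apply/eqP; rewrite eqn_leq (H _ _ _ h1 h3, H _ _ _ h2 h4)
  (H _ _ _ h3 h1, H _ _ _ h4 h2).
Qed.

(* Block 0 is sent to the left, 1 to the right, 2 to the bottom and 3 to the
   top of the four outer middle subsquares of the 3 x 3 subdivision of [c]. *)
Definition cross_pattern K (c : 'I_K * 'I_K) (g : nat) : set (pt R) :=
  subsquare (3 * K) (3 * c.1 + nth 1%N [:: 0; 2; 1; 1]%N g)
                    (3 * c.2 + nth 1%N [:: 1; 1; 0; 2]%N g).

(** The middle column and the middle row of the cell serve as the two strips. With mesh
    [h = 1 / (3 K)], points of one cell differ by at most [3 h] in each coordinate, so both segments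
    have length at most [6 h = 2 / K <= r] and are edges. *)
Lemma occupied_not_plane K m n r (c : 'I_K * 'I_K) w :
  (4 * m <= n)%N -> 2 <= r * K%:R ->
  occupied X (@cross_pattern K) m c w -> ~ rgg_plane (X ^~ w) n r.
Proof.
move=> mn rK; have K0 : (0 < K)%N by apply: leq_ltn_trans (ltn_ord c.1).
rewrite /occupied !big_ord_recl big_ord0 setIT /=.
move=> [/not_avoid[i0 g0 h0] [/not_avoid[i1 g1 h1] [/not_avoid[i2 g2 h2]]]].
move=> /not_avoid[i3 g3 h3].
move: g0 g1 g2 g3; rewrite !mem_iota /bump /= => g0 g1 g2 g3.
have [n0 n1 n2 n3] : [/\ i0 < n, i1 < n, i2 < n & i3 < n]%N.
  by move: g0 g1 g2 g3 mn; clear=> *; split; lia.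
have [n01 n23 n02 n03] : [/\ i0 <> i1, i2 <> i3, i0 <> i2 & i0 <> i3].
  by move: g0 g1 g2 g3; clear=> *; split; lia.
move: h0 h1 h2 h3; rewrite /cross_pattern /bump /=.
move e0 : (X i0 w) => p0; move e1 : (X i1 w) => p1.
move e2 : (X i2 w) => p2; move e3 : (X i3 w) => p3.
rewrite !addn0 !addn1 !addn2.
set U := (3 * c.1)%N; set V := (3 * c.2)%N; set M := (3 * K)%N.
have M0 : 0 < M%:R :> R by rewrite ltr0n muln_gt0.
pose h : R := M%:R^-1; have hp : 0 < h by rewrite invr_gt0.
have h6 : 6 * h <= r.
  by rewrite /h ler_pdivrMr// /M natrM; lra.
have k1 (k : nat) : k.+1%:R / M%:R = k%:R / M%:R + h by rewrite -natr1 mulrDl mul1r.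
move=> /subsquareP[a0 b0] /subsquareP[a1 b1] /subsquareP[a2 b2] /subsquareP[a3 b3].
have sc : seg_cross p0 p1 p2 p3.
  apply: (@seg_cross_strips _ _ _ _ _ (U.+1%:R / M%:R) (U.+2%:R / M%:R)
    (V.+1%:R / M%:R) (V.+2%:R / M%:R)) => //; by case/andP: a0 a1 b2 b3 => *; lra.
move: a0 b0 a1 b1 a2 b2 a3 b3; rewrite !k1.
move=> /andP[? ?] /andP[? ?] /andP[? ?] /andP[? ?].
move=> /andP[? ?] /andP[? ?] /andP[? ?] /andP[? ?].
have d01 : edist p0 p1 <= r.
  apply: (le_trans (@edist_le_box _ _ _ (3 * h) _ _)); rewrite ?ler_norml; lra.
have d23 : edist p2 p3 <= r.
  apply: (le_trans (@edist_le_box _ _ _ (3 * h) _ _)); rewrite ?ler_norml; lra.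
move=> /(_ i0 i1 i2 i3); rewrite e0 e1 e2 e3; apply=> //.
- by do 3!split=> //; rewrite e0 e1.
- by do 3!split=> //; rewrite e2 e3.
- by case=> -[].
Qed.

Lemma bernoulli_le (x : R) m : 0 <= x -> 1 + m%:R * x <= (1 + x) ^+ m.
Proof.
move=> x0; elim: m => [|m IH]; first by rewrite mul0r addr0 expr0.
rewrite exprS -natr1; apply: (le_trans _ (ler_wpM2l _ IH)); last by lra.
have : 0 <= m%:R * (x * x) :> R by rewrite !mulr_ge0.
by lra.
Qed.

(** From [(1 - p)^m (1 + p)^m <= 1] and Bernoulli's inequality, [(1 - p)^m <= 1 / (1 + m p)]. *)
Lemma hit_lower_bound (p : R) m : 0 < p <= 1 -> (0 < m)%N ->
  m%:R * p / (1 + m%:R * p) <= 1 - (1 - p) ^+ m.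
Proof.
move=> /andP[p0 p1] m0; have m0' : 0 < m%:R :> R by rewrite ltr0n.
have y0 : 0 < m%:R * p by rewrite mulr_gt0.
have b := bernoulli_le m (ltW p0).
have c : (1 - p) ^+ m * (1 + p) ^+ m <= 1.
  by rewrite -exprMn exprn_ile1//; nra.
have e0 : 0 <= (1 - p) ^+ m by rewrite exprn_ge0// subr_ge0.
have := le_trans (ler_wpM2l e0 b) c.
rewrite ler_pdivrMr; last by lra.
by nra.
Qed.

(** The mean is [mu = K^2 q^4] with [1 / q <= 1 + z], where [z = 1 / (m p) = 9 K^2 / m]; expanding
    by [(1 + z)^4 <= 8 + 8 z^4] yields the two error terms. *)
Lemma pr_not_plane_ge K m n r : (1 < K)%N -> (0 < m)%N -> (4 * m <= n)%N ->
  2 <= r * K%:R ->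
  1 - 8 / K%:R ^+ 2 - 8 * 9 ^+ 4 * K%:R ^+ 6 / m%:R ^+ 4 <=
  pr [set w | ~ rgg_plane (X ^~ w) n r].
Proof.
move=> K1 m0 mn rK; have K0 : (0 < K)%N by exact: ltnW.
have K0' : 0 < K%:R :> R by rewrite ltr0n.
have m0' : 0 < m%:R :> R by rewrite ltr0n.
pose M := (3 * K)%N; have M0 : (0 < M)%N by rewrite muln_gt0.
have M0' : 0 < M%:R :> R by rewrite ltr0n.
pose p : R := M%:R^-1 * M%:R^-1.
have p0 : 0 < p by rewrite mulr_gt0// invr_gt0.
have p2 : p <= 1 / 2.
  have iM : M%:R^-1 <= 1 / 2 :> R.
    rewrite mul1r lef_pV2 ?posrE// ler_nat /M.
    by move: K1; clear; lia.
  have : 0 < M%:R^-1 :> R by rewrite invr_gt0.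
  by rewrite /p; nra.
have mS c g : measurable (@cross_pattern K c g) by exact: measurable_subsquare.
(* The default value 1 of [nth] matters: for [g >= 4] the pattern is the central subsquare, so the
   hypotheses on the targets hold for every [g]. *)
have off (s : seq nat) g : all (leq^~ 2) s -> (nth 1 s g <= 2)%N.
  move=> /all_nthP h; have [gs|gs] := ltnP g (size s); first exact: h.
  by rewrite nth_default.
have pS c g i : pr (X i @^-1` @cross_pattern K c g) = p.
  have ox := @off [:: 0; 2; 1; 1]%N g isT; have oy := @off [:: 1; 1; 0; 2]%N g isT.
  have hu := ltn_ord c.1; have hv := ltn_ord c.2.
  apply: pr_subsquare => //; rewrite /M.
    by move: hu ox; clear; lia.
  by move: hv oy; clear; lia.
have dS c c' g : c != c' -> @cross_pattern K c g `&` @cross_pattern K c' g = set0.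
  move=> cc; apply/seteqP; split=> z // [hz hz'].
  have [] := subsquare_inj M0 hz hz'; move=> /addIn h1 /addIn h2.
  move/eqP: cc; case: c c' h1 h2 {hz hz'} => [u v] [u' v'] /= h1 h2; apply.
  by congr pair; apply: val_inj => /=; move: h1 h2; clear; lia.
pose q := 1 - (1 - p) ^+ m.
have q0 : m%:R * p / (1 + m%:R * p) <= q by apply: hit_lower_bound => //; lra.
have y0 : 0 < m%:R * p by rewrite mulr_gt0.
have y1 : 0 < m%:R * p / (1 + m%:R * p) by rewrite divr_gt0// addr_gt0.
have qp : 0 < q by exact: lt_le_trans q0.
pose s := enum {: 'I_K * 'I_K}.
have sz : (size s)%:R = K%:R ^+ 2 :> R.
  by rewrite -cardE card_prod card_ord natrM.
have mu0 : 0 < (size s)%:R * q ^+ 4 by rewrite sz mulr_gt0// exprn_gt0.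
have := pr_some_occupied mX X_indep mS pS dS (enum_uniq _ : uniq s) p2 mu0.
rewrite -/q -/s sz => L.
have U : pr (\big[setU/set0]_(c <- s) occupied X (@cross_pattern K) m c) <=
    pr [set w | ~ rgg_plane (X ^~ w) n r].
  apply: le_pr.
  - by apply: measurable_big_setU => c; exact: measurable_occupied.
  - by apply: measurableC; exact: measurable_rgg_plane.
  - move=> w; rewrite -bigcup_seq => -[c _]; exact: occupied_not_plane.
apply: le_trans U; apply: le_trans L.
suff : (K%:R ^+ 2 * q ^+ 4)^-1 <=
    8 / K%:R ^+ 2 + 8 * 9 ^+ 4 * K%:R ^+ 6 / m%:R ^+ 4 by lra.
pose z : R := (m%:R * p)^-1.
have z0 : 0 <= z by rewrite invr_ge0 ltW.
have qi : q^-1 <= 1 + z.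
  have -> : 1 + z = (m%:R * p / (1 + m%:R * p))^-1.
    by rewrite /z; field; rewrite !gt_eqF//= addr_gt0.
  by rewrite lef_pV2 ?posrE.
have zE : z = 9 * K%:R ^+ 2 / m%:R.
  by rewrite /z /p /M natrM; field; rewrite !gt_eqF.
have z4 : (1 + z) ^+ 4 <= 8 + 8 * z ^+ 4.
  have s1 : (1 + z) ^+ 2 <= 2 + 2 * z ^+ 2 by have := sqr_ge0 (1 - z); nra.
  have s2 : (2 + 2 * z ^+ 2) ^+ 2 <= 8 + 8 * z ^+ 4.
    by have := sqr_ge0 (1 - z ^+ 2); nra.
  apply: le_trans s2; rewrite (exprM _ 2 2); apply: lerXn2r => //.
    by rewrite nnegrE exprn_ge0// addr_ge0.
  by rewrite nnegrE addr_ge0// mulr_ge0// sqr_ge0.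
rewrite invfM -(exprVn q).
apply: (@le_trans _ _ (K%:R ^- 2 * (8 + 8 * z ^+ 4))).
  apply: ler_wpM2l; first by rewrite invr_ge0 exprn_ge0.
  apply: le_trans z4; apply: lerXn2r => //; rewrite nnegrE.
    by rewrite invr_ge0 ltW.
  by rewrite addr_ge0.
rewrite le_eqVlt; apply/orP; left; apply/eqP; rewrite zE.
by field; rewrite !gt_eqF.
Qed.

End lower_bound.

(** * Below the threshold: a union bound over a grid *)

Section upper_bound.
Context (d : measure_display) (T : measurableType d) (R : realType).
Variables (P : probability T R) (X : nat -> T -> pt R).
Hypothesis mX : forall i, measurable_fun setT (X i).
Hypothesis X_indep : iid_indep P X.
Hypothesis X_unif : forall i, unif_square P (X i).
Local Notation pr := (pr P).

(** Closed cells, so that they cover the whole closed unit square; overlaps are harmless in a union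
    bound. *)
Definition cell K (c : 'I_K * 'I_K) : set (pt R) :=
  `[c.1%:R / K%:R, (c.1%:R + 1) / K%:R] `*` `[c.2%:R / K%:R, (c.2%:R + 1) / K%:R].

Definition enlarged_cell K (c : 'I_K * 'I_K) : set (pt R) :=
  `[(c.1%:R - 1) / K%:R, (c.1%:R + 2) / K%:R] `*`
  `[(c.2%:R - 1) / K%:R, (c.2%:R + 2) / K%:R].

Lemma lebesgue_measure_itvcc_div (x y k : R) : 0 < k -> x <= y ->
  lebesgue_measure (`[x / k, y / k] : set R) = ((y - x) / k)%:E.
Proof.
move=> k0 xy; rewrite lebesgue_measure_itv /= lte_fin ltr_pM2r ?invr_gt0//.
move: xy; rewrite le_eqVlt => /orP[/eqP->|->].
  by rewrite ltxx subrr mul0r.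
by rewrite -EFinB mulrBl.
Qed.

Lemma pr_cell_le i K (c : 'I_K * 'I_K) : (0 < K)%N ->
  pr (X i @^-1` cell c) <= K%:R^-1 ^+ 2.
Proof.
move=> K0; have K0' : 0 < K%:R :> R by rewrite ltr0n.
have len (a : nat) : lebesgue_measure
    (`[a%:R / K%:R, (a%:R + 1) / K%:R] : set R) = (K%:R^-1)%:E.
  by rewrite lebesgue_measure_itvcc_div ?lerDl// addrAC subrr add0r mul1r.
exact: (pr_unif_le mX X_unif).
Qed.

Lemma pr_enlarged_cell_le i K (c : 'I_K * 'I_K) : (0 < K)%N ->
  pr (X i @^-1` enlarged_cell c) <= 9 * K%:R^-1 ^+ 2.
Proof.
move=> K0; have K0' : 0 < K%:R :> R by rewrite ltr0n.
have len (a : nat) : lebesgue_measure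
    (`[(a%:R - 1) / K%:R, (a%:R + 2) / K%:R] : set R) = (3 / K%:R)%:E.
  by rewrite lebesgue_measure_itvcc_div//; [congr (_ / _)%:E|]; lra.
have -> : 9 * K%:R^-1 ^+ 2 = (3 / K%:R) * (3 / K%:R) :> R by ring.
exact: (pr_unif_le mX X_unif).
Qed.

Lemma unit_interval_grid K (x : R) : (0 < K)%N -> 0 <= x <= 1 ->
  exists a : 'I_K, a%:R / K%:R <= x <= (a%:R + 1) / K%:R.
Proof.
move=> K0 /andP[x0 x1]; have K0' : 0 < K%:R :> R by rewrite ltr0n.
have [a aK] : exists2 a, (a < K)%N & (a%:R : R) <= x * K%:R <= a%:R + 1.
  have : 0 <= x * K%:R by rewrite mulr_ge0.
  have : x * K%:R <= K%:R by rewrite ler_piMl.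
  move: (x * K%:R) K0 => y; elim: K {K0'} => // K IH _ yK y0.
  have [yK'|yK'] := leP y K%:R; last first.
    by exists K => //; rewrite natr1 yK ltW.
  case: K IH yK yK' => [|K] IH yK yK'; first by exists 0%N; rewrite // natr1 y0.
  by have [a aK h] := IH isT yK' y0; exists a => //; apply: ltnW.
by move=> h; exists (Ordinal aK); rewrite ler_pdivrMr// ler_pdivlMr.
Qed.

(** Point [i] lies in some cell and the other three in the 3 x 3 block of cells around it. The first
    alternative, of probability zero, is there because uniformity puts [X i] in the unit square only
    almost surely. *)
Definition clustered K (i j k l : nat) : set T :=
  (X i @^-1` ~` (`[0, 1] `*` `[0, 1])) `|`
  \big[setU/set0]_(c <- enum {: 'I_K * 'I_K})
    \big[setI/setT]_(t <- [:: i; j; k; l])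
      X t @^-1` (if t == i then cell c else enlarged_cell c).

Let mcells K (c : 'I_K * 'I_K) (i t : nat) :
  measurable (if t == i then cell c else enlarged_cell c).
Proof. by case: ifP => _; exact: measurableX. Qed.

Let mout i : measurable (X i @^-1` ~` (`[0, 1] `*` `[0, 1])).
Proof. by apply: measurable_preX => //; apply: measurableC; exact: measurableX. Qed.

Let mclustered' K i j k l : measurable (\big[setU/set0]_(c <- enum {: 'I_K * 'I_K})
    \big[setI/setT]_(t <- [:: i; j; k; l])
      X t @^-1` (if t == i then cell c else enlarged_cell c)).
Proof.
by apply: measurable_big_setU => c; apply: measurable_big_preX => // t; exact: mcells.
Qed.

Lemma measurable_clustered K i j k l : measurable (clustered K i j k l).
Proof. by apply: measurableU; [exact: mout|exact: mclustered']. Qed.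

(** There are [K^2] cells, each contributing at most [K^-2] for the first point and [9 K^-2] for
    each of the other three. *)
Lemma pr_clustered_le K i j k l : (0 < K)%N -> uniq [:: i; j; k; l] ->
  pr (clustered K i j k l) <= 9 ^+ 3 * K%:R^-1 ^+ 6.
Proof.
move=> K0 u; have K0' : 0 < K%:R :> R by rewrite ltr0n.
apply: (@le_trans _ _ (\sum_(c <- enum {: 'I_K * 'I_K})
    (K%:R^-1 ^+ 2 * (9 * K%:R^-1 ^+ 2) ^+ 3))); last first.
  rewrite big_const_seq count_predT iter_addr_0 -cardE card_prod card_ord.
  rewrite -[leLHS]mulr_natl natrM le_eqVlt; apply/orP; left; apply/eqP.
  by field; rewrite gt_eqF.
apply: (le_trans (prU_le P (mout i) (mclustered' K i j k l))).
rewrite pr_outside// add0r.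
apply: (le_trans (pr_union_le _ _ _)) => [c|].
  by apply: measurable_big_preX => // t; exact: mcells.
apply: ler_sum => c _; rewrite (pr_indep mX X_indep u (mcells c i)).
move: u; rewrite /= !inE !negb_or -!andbA => /and5P[ij ik il _ _].
rewrite !big_cons big_nil mulr1 eqxx !(eq_sym _ i) (negbTE ij) (negbTE ik) (negbTE il).
apply: ler_pM => //; first exact: pr_ge0.
- by rewrite !mulr_ge0 ?pr_ge0.
- exact: pr_cell_le.
rewrite exprS; apply: ler_pM; rewrite ?pr_ge0 ?mulr_ge0 ?pr_ge0 ?pr_enlarged_cell_le//.
by rewrite expr2; apply: ler_pM; rewrite ?pr_ge0 ?pr_enlarged_cell_le.
Qed.

Lemma clustered_of_near K i j k l w (h : R) : (0 < K)%N -> h <= K%:R^-1 ->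
  uniq [:: i; j; k; l] ->
  (forall t, t \in [:: j; k; l] ->
    `|(X t w).1 - (X i w).1| <= h /\ `|(X t w).2 - (X i w).2| <= h) ->
  clustered K i j k l w.
Proof.
move=> K0 hK u near.
have [Qw|Qw] := pselect ((`[0, 1] `*` `[0, 1]) (X i w)); last by left.
right; move: Qw => [/=]; rewrite !in_itv /= => h1 h2.
have [a ha] := unit_interval_grid K0 h1; have [b hb] := unit_interval_grid K0 h2.
rewrite -bigcup_seq; exists (a, b); first by rewrite /= mem_enum.
have nearP t : t \in [:: j; k; l] -> enlarged_cell (a, b) (X t w).
  move=> /near; rewrite !ler_norml => -[/andP[g1 g2] /andP[g3 g4]].
  move: ha hb => /andP[a1 a2] /andP[b1 b2].
  rewrite !mulrDl !mul1r in a2 b2.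
  split; rewrite /= in_itv /= !mulrDl; apply/andP; split; lra.
have cellP : cell (a, b) (X i w) by split; rewrite /= in_itv /=.
move: u; rewrite /= !inE !negb_or -!andbA => /and5P[ij ik il _ _].
rewrite !big_cons big_nil eqxx !(eq_sym _ i) (negbTE ij) (negbTE ik) (negbTE il).
split; first exact: cellP.
split; first by apply: nearP; rewrite !inE eqxx.
split; first by apply: nearP; rewrite !inE eqxx orbT.
by split=> //; apply: nearP; rewrite !inE eqxx !orbT.
Qed.

Lemma not_plane_cases n r w : ~ rgg_plane (X ^~ w) n r ->
  (exists i j k : 'I_n, uniq [:: val i; val j; val k] /\
     collinear (X i w) (X j w) (X k w)) \/
  (exists i j k l : 'I_n, uniq [:: val i; val j; val k; val l] /\
     forall t, t \in [:: val j; val k; val l] ->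
       `|(X t w).1 - (X i w).1| <= 2 * r /\ `|(X t w).2 - (X i w).2| <= 2 * r).
Proof.
move=> /existsNP[i /existsNP[j /existsNP[k /existsNP[l]]]].
move=> /not_implyP[[iN [jN [/eqP ij dij]]] /not_implyP[[kN [lN [/eqP kl dkl]]]]].
move=> /not_implyP[ne /contrapT X4].
have cross_swap (a b c e : R * R) : seg_cross a b c e ->
    seg_cross b a c e /\ seg_cross a b e c.
  by rewrite /seg_cross (open_segC a b) (open_segC c e).
have tri (a b c : nat) : (a < n)%N -> (b < n)%N -> (c < n)%N ->
    a != b -> a != c -> b != c ->
    seg_cross (X a w) (X b w) (X a w) (X c w) ->
    exists i j k : 'I_n, uniq [:: val i; val j; val k] /\
      collinear (X i w) (X j w) (X k w).
  move=> aN bN cN ab ac bc /seg_cross_collinear X3.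
  exists (Ordinal aN), (Ordinal bN), (Ordinal cN); split=> //=.
  by rewrite !inE negb_or ab ac bc.
(* Two distinct edges can share an endpoint in four ways; reversing segments brings each to the form
   with a common first endpoint. *)
have [eik|nik] := eqVneq i k.
  left; subst k; apply: (tri i j l) => //.
  by apply/eqP => jl; apply: ne; left.
have [eil|nil] := eqVneq i l.
  left; subst l; apply: (tri i j k) => //; last by have [] := cross_swap _ _ _ _ X4.
  by apply/eqP => jk; apply: ne; right.
have [ejk|njk] := eqVneq j k.
  left; subst k; apply: (tri j i l) => //; first by rewrite eq_sym.
  by have [] := cross_swap _ _ _ _ X4.
have [ejl|njl] := eqVneq j l.
  left; subst l; apply: (tri j i k) => //; first by rewrite eq_sym.
  have [X4' _] := cross_swap _ _ _ _ X4.
  by have [] := cross_swap _ _ _ _ X4'.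
right; exists (Ordinal iN), (Ordinal jN), (Ordinal kN), (Ordinal lN); split.
  by rewrite /= !inE !negb_or ij nik nil njk njl kl.
move=> t /= tin; apply: (seg_cross_near dij dkl X4).
by move: tin; rewrite !inE => /or3P[] /eqP ->; [left|right; left|right; right].
Qed.

(** Union bound: collinear triples contribute nothing, and there are at most [n^4] quadruples of
    indices. *)
Lemma pr_not_plane_le K n r : (0 < K)%N -> 2 * r <= K%:R^-1 ->
  pr [set w | ~ rgg_plane (X ^~ w) n r] <= n%:R ^+ 4 * (9 ^+ 3 * K%:R^-1 ^+ 6).
Proof.
move=> K0 rK.
pose A (t : 'I_n * 'I_n * 'I_n) : set T := let: (i, j, k) := t in
  if uniq [:: val i; val j; val k] then
    [set w | collinear (X i w) (X j w) (X k w)] else set0.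
pose B (t : 'I_n * 'I_n * 'I_n * 'I_n) : set T := let: (i, j, k, l) := t in
  if uniq [:: val i; val j; val k; val l] then clustered K i j k l else set0.
have mA t : measurable (A t).
  by case: t => [[i j] k] /=; case: ifP => // _; exact: measurable_collinear.
have mB t : measurable (B t).
  by case: t => [[[i j] k] l] /=; case: ifP => // _; exact: measurable_clustered.
pose UA := \big[setU/set0]_(t <- enum {: 'I_n * 'I_n * 'I_n}) A t.
pose UB := \big[setU/set0]_(t <- enum {: 'I_n * 'I_n * 'I_n * 'I_n}) B t.
have mUA : measurable UA by exact: measurable_big_setU.
have mUB : measurable UB by exact: measurable_big_setU.
have sub : [set w | ~ rgg_plane (X ^~ w) n r] `<=` UA `|` UB.
  move=> w /= /not_plane_cases[[i [j [k [u h]]]]|[i [j [k [l [u h]]]]]].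
    left; rewrite /UA -bigcup_seq; exists (i, j, k); first by rewrite /= mem_enum.
    by rewrite /A u.
  right; rewrite /UB -bigcup_seq; exists (i, j, k, l); first by rewrite /= mem_enum.
  by rewrite /B u; exact: clustered_of_near rK u h.
apply: (@le_trans _ _ (pr UA + pr UB)).
  apply: le_trans (prU_le P mUA mUB); apply: le_pr sub.
    by apply/measurableC/measurable_rgg_plane.
  exact: measurableU.
have -> : pr UA = 0.
  apply/eqP; rewrite eq_le pr_ge0 andbT; apply: (le_trans (pr_union_le _ _ _)) => //.
  rewrite big1// => -[[i j] k] _; rewrite /A /pr; case: ifP => [u|_].
    by rewrite collinear_null.
  by rewrite measure0.
rewrite add0r; apply: (le_trans (pr_union_le _ _ _)) => //.
apply: (@le_trans _ _ (\sum_(t <- enum {: 'I_n * 'I_n * 'I_n * 'I_n})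
    (9 ^+ 3 * K%:R^-1 ^+ 6))).
  apply: ler_sum => -[[[i j] k] l] _; rewrite /B; case: ifP => [u|_].
    exact: pr_clustered_le.
  by rewrite /pr measure0 mulr_ge0 ?exprn_ge0 ?invr_ge0.
rewrite big_const_seq count_predT iter_addr_0 -cardE !card_prod !card_ord.
by rewrite -[leLHS]mulr_natl !natrM -expr2 -!exprSr.
Qed.

End upper_bound.

(** * Passage to the limit *)

Lemma powR_two_thirds (R : realType) (n : nat) :
  (n%:R `^ (2 / 3) : R) ^+ 6 = n%:R ^+ 4.
Proof.
rewrite -powR_mulrn ?powR_ge0// -powRrM -powR_mulrn//.
by congr (_ `^ _); lra.
Qed.

Lemma cvg_scaled_power (R : realType) (c : R) (k : nat) (f : nat -> R) :
  f n @[n --> \oo] --> 0 -> c * f n ^+ k.+1 @[n --> \oo] --> 0.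
Proof.
move=> f0; have : c * f n ^+ k.+1 @[n --> \oo] --> c * 0 ^+ k.+1.
  apply: cvgM; first exact: cvg_cst.
  by apply: (@cvg_comp _ _ _ f (fun y => y ^+ k.+1) _ _ _ f0); exact: exprn_continuous.
by rewrite expr0n mulr0.
Qed.

Lemma cvg_probability1 (d : measure_display) (T : measurableType d)
    (R : realType) (P : probability T R) (A : nat -> set T) (e : nat -> R) :
  (forall n, measurable (A n)) ->
  (\forall n \near \oo, 1 - e n <= pr P (A n)) ->
  e n @[n --> \oo] --> 0 -> P (A n) @[n --> \oo] --> 1%E.
Proof.
move=> mA eA e0; apply: cvg_EFin; first by apply: nearW => n; rewrite fin_num_measure.
apply: (@squeeze_cvgr _ _ _ _ (fun n => 1 - e n) (fun=> 1)); last exact: cvg_cst.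
  by near=> n; rewrite pr_le1// andbT; near: n.
by rewrite -[X in _ --> X]subr0; apply: cvgB => //; exact: cvg_cst.
Unshelve. all: by end_near. Qed.

Theorem theorem4 (d : measure_display) (T : measurableType d) (R : realType)
    (P : probability T R) (X : nat -> T -> pt R)
    (X_meas : forall i, measurable_fun setT (X i))
    (X_indep : iid_indep P X)
    (X_unif : forall i, unif_square P (X i))
    (r : nat -> R) (r_pos : forall n, 0 < r n)
    (r_to0 : r n @[n --> \oo] --> 0) :
  ((r n * (n%:R `^ (2 / 3))) @[n --> \oo] --> 0 ->
     (P [set w | rgg_plane (fun i => X i w) n (r n)])%E @[n --> \oo] --> 1%E)
  /\
  ((r n * (n%:R `^ (2 / 3))) @[n --> \oo] --> +oo ->
     (P [set w | ~ rgg_plane (fun i => X i w) n (r n)])%E @[n --> \oo] --> 1%E).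
Proof.
split=> [rn0|rnoo].
  pose e n : R := 9 ^+ 3 * 4 ^+ 6 * (r n * n%:R `^ (2 / 3)) ^+ 6.
  apply: (@cvg_probability1 _ _ _ _ _ e).
  - by move=> n; exact: measurable_rgg_plane.
  - near=> n.
    have r4 : r n <= 1 / 4.
      by near: n; apply: (cvgr_le _ r_to0); lra.
    have rp := r_pos n.
    (* [K] is the integer part of [1 / (2 r)], the finest grid with [2 r <= 1 / K]. Since [K > 1],
       rounding down loses at most a factor 2, whence [1 / K <= 4 r]; this is the source of [4 ^+ 6]
       in [e]. *)
    pose y := (2 * r n)^-1; have y2 : 2 <= y.
      by rewrite /y -[leLHS]invrK lef_pV2 ?posrE//; lra.
    pose K := Num.truncn y.
    have /andP[Ky yK] : K%:R <= y < K.+1%:R by apply: truncn_itv; lra.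
    have K2 : (1 < K)%N by rewrite -ltnS -(ltr_nat R) (le_lt_trans y2).
    have K0 : 0 < K%:R :> R by rewrite ltr0n ltnW.
    have rK : 2 * r n <= K%:R^-1.
      by rewrite -[leLHS]invrK lef_pV2 ?posrE// /y invr_gt0; lra.
    have Kr : K%:R^-1 <= 4 * r n.
      have -> : 4 * r n = (y / 2)^-1 by rewrite /y; field; rewrite gt_eqF.
      rewrite lef_pV2 ?posrE//; last by lra.
      have : 1 < K%:R :> R by rewrite ltr1n.
      by move: yK; rewrite -natr1; lra.
    have /= := pr_not_plane_le X_meas X_indep X_unif n (ltnW K2) rK.
    rewrite [X in pr P X](_ : _ = ~` [set w | rgg_plane (X ^~ w) n (r n)])//.
    rewrite prC; last exact: measurable_rgg_plane.
    have : n%:R ^+ 4 * (9 ^+ 3 * K%:R^-1 ^+ 6) <= e n.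
      rewrite /e exprMn powR_two_thirds.
      have : K%:R^-1 ^+ 6 <= (4 * r n) ^+ 6.
        by rewrite lerXn2r ?nnegrE ?invr_ge0// mulr_ge0// ltW.
      move=> /(ler_wpM2l (_ : 0 <= n%:R ^+ 4 * 9 ^+ 3 :> R)).
      rewrite mulr_ge0 ?exprn_ge0// => /(_ isT) h.
      by rewrite mulrA (le_trans h)// le_eqVlt; apply/orP; left; apply/eqP; ring.
    by move=> h1 h2; lra.
  - exact: cvg_scaled_power.
(* The factor [8 * 9 ^+ 4] comes from [pr_not_plane_ge], [3 ^+ 6] from [K <= 3 / r] and [8 ^+ 4]
   from [n <= 8 m]. *)
pose C : R := 8 * 9 ^+ 4 * 3 ^+ 6 * 8 ^+ 4.
pose x n : R := r n * n%:R `^ (2 / 3).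
pose e n : R := 2 * r n ^+ 2 + C * (x n)^-1 ^+ 6.
apply: (@cvg_probability1 _ _ _ _ _ e).
- by move=> n; apply/measurableC/measurable_rgg_plane.
- near=> n.
  have r1 : r n <= 1 by near: n; apply: (cvgr_le _ r_to0); lra.
  have n4 : (4 <= n)%N by near: n; exact: nbhs_infty_ge.
  have rp := r_pos n.
  pose y := 2 / r n; have y2 : 2 <= y by rewrite /y ler_pdivlMr//; lra.
  (* Rounding [2 / r] up gives [2 <= r K], while [r <= 1] gives [K <= 2 / r + 1 <= 3 / r]. *)
  pose K := (Num.truncn y).+1.
  have /andP[Ky yK] : (Num.truncn y)%:R <= y < K%:R by apply: truncn_itv; lra.
  have K1 : (1 < K)%N by rewrite -(ltr_nat R); lra.
  have K0 : 0 < K%:R :> R by rewrite ltr0n ltnW.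
  have rK : 2 <= r n * K%:R by rewrite mulrC -ler_pdivrMr// ltW.
  have Kr : K%:R <= 3 / r n.
    have : 1 <= (r n)^-1 by rewrite invf_ge1.
    by rewrite /K -natr1; rewrite /y in Ky *; lra.
  pose m := (n %/ 4)%N.
  have m0 : (0 < m)%N by rewrite divn_gt0.
  have mn : (4 * m <= n)%N by rewrite mulnC leq_trunc_div.
  have nm : (n <= 8 * m)%N.
    by rewrite /m; move: n4; clear; lia.
  have n0 : 0 < n%:R :> R by rewrite ltr0n (leq_trans _ n4).
  have m0' : 0 < m%:R :> R by rewrite ltr0n.
  apply: le_trans (pr_not_plane_ge X_meas X_indep X_unif K1 m0 mn rK).
  have h1 : 8 / K%:R ^+ 2 <= 2 * r n ^+ 2.
    rewrite ler_pdivrMr ?exprn_gt0// -mulrA -exprMn.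
    have : 2 ^+ 2 <= (r n * K%:R) ^+ 2 by rewrite lerXn2r ?nnegrE// mulr_ge0// ltW.
    by lra.
  have h2 : 8 * 9 ^+ 4 * K%:R ^+ 6 / m%:R ^+ 4 <= C * (x n)^-1 ^+ 6.
    have k6 : K%:R ^+ 6 <= (3 / r n) ^+ 6.
      by rewrite lerXn2r ?nnegrE// ?divr_ge0// ltW.
    have m4 : (m%:R ^- 4 : R) <= (8 / n%:R) ^+ 4.
      rewrite -(exprVn m%:R); apply: lerXn2r; rewrite ?nnegrE ?invr_ge0 ?divr_ge0//.
      rewrite -[leLHS]mul1r ler_pdivrMr// mulrAC ler_pdivlMr// mul1r.
      by rewrite -natrM ler_nat.
    (* The exponent 2/3 enters here: [r^-6 n^-4] is the inverse sixth power of [r n^(2/3)]. *)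
    have -> : C * (x n)^-1 ^+ 6 = 8 * 9 ^+ 4 * ((3 / r n) ^+ 6 * (8 / n%:R) ^+ 4).
      rewrite exprVn /x exprMn powR_two_thirds /C.
      by field; rewrite !gt_eqF.
    rewrite -mulrA ler_wpM2l// ler_pM// ?exprn_ge0// invr_ge0 exprn_ge0//.
  by rewrite /e; lra.
- rewrite /e -[X in _ --> X]addr0; apply: cvgD.
    exact: cvg_scaled_power.
  apply: cvg_scaled_power.
  apply/gtr0_cvgV0 => //; near=> n; rewrite mulr_gt0// powR_gt0// ltr0n.
  by near: n; exact: nbhs_infty_gt.
Unshelve. all: by end_near. Qed.
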